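(* Let $d\ge 1$ and $n\ge 2$ be integers, let $\alpha$ be a real number with $d \leq \alpha < dn$, and let $Z \subset \mathbf{R}^{dn}$ be a countable union of compact sets, each with lower Minkowski dimension at most $\alpha$. Then there exists a set $X \subset [0,1)^d$ with Hausdorff dimension at least $\frac{nd - \alpha}{n-1}$ such that whenever $x_1, \dots, x_n \in X$ are distinct, we have $(x_1, \dots, x_n) \notin Z$.
   Context: Points of $\mathbf{R}^{dn}$ are written $(x_1,\dots,x_n)$ with each $x_i\in\mathbf{R}^d$. For an integer $m\ge1$, a length $l>0$ and $E\subset\mathbf{R}^m$, let $\mathcal{B}^m_l$ be the collection of half-open cubes $[a_1,a_1+l)\times\cdots\times[a_m,a_m+l)$ with $a_1,\dots,a_m\in l\cdot\mathbf{Z}$, and let $\mathcal{B}^m_l(E)=\{I\in\mathcal{B}^m_l : I\cap E\neq\emptyset\}$. The lower Minkowski dimension of a compact set $E\subset\mathbf{R}^m$ is $\liminf_{l\to0}\frac{\log(\#\mathcal{B}^m_l(E))}{\log(1/l)}$. *)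

(* Defs.v *)
From HB Require Import structures.
From mathcomp Require Import all_boot all_order all_algebra finmap.
From mathcomp Require Import all_classical all_reals all_analysis.

Set Implicit Arguments.
Unset Strict Implicit.
Unset Printing Implicit Defensive.

Import Order.TTheory GRing.Theory Num.Theory.
Import numFieldNormedType.Exports.

Local Open Scope classical_set_scope.
Local Open Scope ring_scope.

(* R^m is 'rV[R]_m; its library topology is the product topology. *)

Definition cubes (R : realType) (m : nat) (l : R) : set (set 'rV[R]_m) :=
  [set I : set 'rV[R]_m | exists a : 'rV[int]_m,
     I = [set x : 'rV[R]_m | forall j,
            l * (a 0 j)%:~R <= x 0 j < l * (a 0 j)%:~R + l]].

Definition cubes_meeting (R : realType) (m : nat) (l : R) (E : set 'rV[R]_m) :
    set (set 'rV[R]_m) :=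
  [set I | cubes l I /\ I `&` E !=set0].

(* [fset_set] is junk (empty) on infinite sets, so the count is meaningful for
   bounded [E] only.  [lne 0 = -oo], so the empty set has dimension -oo. *)
Definition lower_minkowski_dim (R : realType) (m : nat) (E : set 'rV[R]_m) :
    \bar R :=
  limf_einf
    (fun l : R => (lne (#|` fset_set (cubes_meeting l E)|%:R)%:E
                   * ((ln (1 / l))^-1)%:E)%E)
    0^'+.

(* The library norm on 'rV[R]_m is the sup norm, whence an explicit Euclidean
   distance for the metric notions below. *)
Definition edist (R : realType) (m : nat) (x y : 'rV[R]_m) : R :=
  Num.sqrt (\sum_(j < m) (x 0 j - y 0 j) ^+ 2).

(* The [maxe] only serves to give the empty set diameter 0. *)
Definition diam (R : realType) (m : nat) (A : set 'rV[R]_m) : \bar R :=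
  maxe 0%E (ereal_sup [set (edist p.1 p.2)%:E | p in A `*` A]).

(* diam(A)^s with the convention that the empty set contributes 0 even for
   s = 0, while a nonempty set contributes 0^0 = 1 if it is a point. *)
Definition diam_pow (R : realType) (m : nat) (s : R) (A : set 'rV[R]_m) :
    \bar R :=
  if A == set0 then 0%E else (diam A `^ s)%E.

Definition hausdorff_premeasure (R : realType) (m : nat) (s delta : R)
    (E : set 'rV[R]_m) : \bar R :=
  ereal_inf [set \sum_(0 <= k <oo) diam_pow s (U k) | U in
    [set U : (set 'rV[R]_m)^nat |
       E `<=` \bigcup_k U k /\ forall k, (diam (U k) <= delta%:E)%E]]%E.

Definition hausdorff_measure (R : realType) (m : nat) (s : R)
    (E : set 'rV[R]_m) : \bar R :=
  ereal_sup [set hausdorff_premeasure s delta E | delta in [set e | 0 < e]].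

Definition hausdorff_dim (R : realType) (m : nat) (E : set 'rV[R]_m) : \bar R :=
  ereal_inf [set s%:E | s in
    [set s : R | 0 <= s /\ hausdorff_measure s E = 0%E]].

(* (x_1, ..., x_n) as a point of R^{dn}, by concatenation. *)
Definition concat_point (R : realType) (d n : nat) (x : 'I_n -> 'rV[R]_d) :
    'rV[R]_(n * d) :=
  mxvec (\matrix_(i < n) x i).

Lemma concat_pointE (R : realType) (d n : nat) (x : 'I_n -> 'rV[R]_d) i j :
  concat_point x 0 (mxvec_index i j) = x i 0 j.
Proof. by rewrite mxvecE mxE. Qed.

(* Main.v *)
Require Import Defs.
From HB Require Import structures.
From mathcomp Require Import all_boot all_order all_algebra finmap.
From mathcomp Require Import all_classical all_reals all_analysis.
From mathcomp Require Import zify ring lra.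
Import Order.TTheory GRing.Theory Num.Theory.
Import numFieldNormedType.Exports.

(** Write beta = (nd - alpha) / (n - 1).  The set X is a Cantor-type set of
dyadic cubes.  Stage k is a finite set S k of dyadic cubes of side
2 ^ - lev k, and each stage destroys the incidences with one of the compact
sets K, every K being treated at infinitely many stages.

One stage goes as follows.  Because K has lower Minkowski dimension at most
alpha, arbitrarily fine scales 2 ^ - j' exist at which K meets only about
2 ^ (j' * alpha) cubes (compact_dyadically_thin).  Choose an intermediate level
i, cut each cube of S k into its subcubes of level i, and let each of these
choose one cube of level j' at random.  A cube of the product space that meets
K, with its n factors in distinct cubes of level i, is selected with
probability about 2 ^ (- n * d * (j' - i)), so the expected number of selected
cubes is about 2 ^ (j' * alpha - n * d * (j' - i)).  When d * i is slightly less
than j' * beta this is at most half the number of level i cubes in a single cube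
of S k; deleting one factor of each selected incidence then leaves every
cube of S k with at least half of its choices, and these are trimmed to
exactly half (random_choice, refine_avoiding, exists_refinement).  The new
stage has about 2 ^ (d * i) = 2 ^ (j' * beta) cubes, and no n of them, if
distinct, have a product that meets K.  Distinct points of X lie in
distinct cubes at every late stage, so X avoids Z.

For the dimension, let every cube of S k have mass 1 / #(S k): this is
consistent, since all cubes of a stage have equally many children.  Between the
levels lev k and i the children are spread like Lebesgue measure on a cube of
S k, and between i and j' there is a single child in each cube.
As s < beta <= d, both regimes give mass O(t ^ s) to the cubes meeting a set of
diameter t (ball_share).  If X were covered by sets with small total
diam ^ s, the cubes blocked by the cover would have total mass less than 1.
Rather than building a measure, one descends the tree, always keeping
to a cube in which the blocked cubes do not fill the whole mass
(escaping_branch); the point at the end of this branch lies in X and in no set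
of the cover.  Hence the s-dimensional measure of X is not 0
for any s < beta. *)

Set Implicit Arguments.
Unset Strict Implicit.
Unset Printing Implicit Defensive.

(** * Random choice *)

(** The first-moment method.  A choice function s selects a tuple b when it
sends the first component of each entry to the second.  The first components
are distinct, so b is selected by #|Q| ^ (#|P| - n) of the #|Q| ^ #|P|
functions, and the average number of selected bad tuples is at most M. *)
Lemma random_choice (P Q : finType) (n : nat)
    (bad : {set {ffun 'I_n -> P * Q}}) (M : nat) :
    0 < #|Q| ->
    {in bad, forall b : {ffun 'I_n -> P * Q}, injective (fun i => (b i).1)} ->
    #|bad| <= M * #|Q| ^ n ->
  exists s : {ffun P -> Q},
    #|[set b in bad | [forall i, s (b i).1 == (b i).2]]| <= M.
Proof.
move=> Q0 inj le_bad.
case: (set_0Vmem bad) => [bad0|[b0 b0bad]].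
  have /card_gt0P[q _] := Q0; exists [ffun=> q].
  rewrite (_ : [set _ in _ | _] = finset.set0) ?cards0 //.
  by apply/setP => b; rewrite bad0 !inE.
have le_nP : n <= #|P|.
  by rewrite -{1}(card_ord n); apply: leq_card (inj _ b0bad).
have compat b : b \in bad ->
    #|[set s : {ffun P -> Q} | [forall i, s (b i).1 == (b i).2]]|
      = #|Q| ^ (#|P| - n).
  move=> bbad; pose A := codom (fun i => (b i).1).
  pose G p : {pred Q} :=
    [pred q | [forall i, ((b i).1 == p) ==> (q == (b i).2)]].
  have cG p : #|G p| = if p \in A then 1 else #|Q|.
    case: ifP => [/codomP[i ->]|pA].
      rewrite -(card1 (b i).2); apply: eq_card => q; rewrite !inE.
      apply/forallP/eqP => [/(_ i)|-> j]; first by rewrite eqxx => /eqP.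
      by apply/implyP => /eqP/(inj _ bbad) ->.
    apply: eq_card => q; rewrite !inE; apply/forallP => i.
    by apply/implyP => /eqP e; rewrite -e (codom_f (fun j => (b j).1) i) in pA.
  transitivity #|(family G : {pred {ffun P -> Q}})|.
    apply: eq_card => s; rewrite inE.
    apply/forallP/familyP => [h p|h i].
      by rewrite inE; apply/forallP => i; apply/implyP => /eqP <-; exact: h.
    by have /forallP/(_ i) := h (b i).1; rewrite eqxx.
  rewrite card_family foldrE big_map big_enum /=.
  rewrite (eq_bigr _ (fun p _ => cG p)) (bigID (mem A)) /=.
  rewrite big1 => [|p ->//]; rewrite mul1n.
  rewrite (eq_bigr (fun=> #|Q|)) => [|p /negPf -> //].
  rewrite prod_nat_const; congr (_ ^ _); rewrite -(cardC (mem A)).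
  by rewrite card_codom ?card_ord ?addKn //; exact: inj.
apply/existsP; apply: contraTT le_bad.
rewrite negb_exists -ltnNge => /forallP many.
rewrite -(ltn_pmul2r (_ : 0 < #|Q| ^ (#|P| - n))); last by rewrite expn_gt0 Q0.
rewrite -mulnA -expnD subnKC //.
pose sel (b : {ffun 'I_n -> P * Q}) (s : {ffun P -> Q}) :=
  [forall i, s (b i).1 == (b i).2].
have -> : #|bad| * #|Q| ^ (#|P| - n)
    = \sum_(s : {ffun P -> Q}) #|[set b in bad | sel b s]|.
  rewrite -sum_nat_const.
  rewrite (eq_bigr (fun b => #|[set s | sel b s]|)); last first.
    by move=> b bbad; rewrite -(compat b bbad).
  under eq_bigr do rewrite -sum1dep_card.
  rewrite (exchange_big_dep predT) //=; apply: eq_bigr => s _.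
  by rewrite -sum1dep_card.
rewrite mulnC -card_ffun -sum_nat_const.
have /card_gt0P[q _] := Q0.
rewrite (bigD1 [ffun=> q]) //= [ltnRHS](bigD1 [ffun=> q]) //= -addSn.
apply: leq_add; first by have := many [ffun=> q]; rewrite -ltnNge.
by apply: leq_sum => s _; have := many s; rewrite -ltnNge => /ltnW.
Qed.

(** * Dyadic cells and the refinement of a stage *)

(** The vector v stands, at a level j known from the context, for the cube of
the points x with v a <= 2 ^ j * x a < v a + 1 for all a. *)
Definition cell (d : nat) := {ffun 'I_d -> nat}.

Definition coarsen (d e : nat) (v : cell d) : cell d :=
  [ffun a => v a %/ 2 ^ e].

Lemma coarsen0 d (v : cell d) : coarsen 0 v = v.
Proof. by apply/ffunP => a; rewrite ffunE expn0 divn1. Qed.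

Lemma coarsenD d e f (v : cell d) : coarsen e (coarsen f v) = coarsen (f + e) v.
Proof. by apply/ffunP => a; rewrite !ffunE expnD divnMA. Qed.

(** The combinatorial core of one stage.  There are p levels from S to the
intermediate level and q.+1 from there to S'.  Each cell of intermediate level
picks one of its 2 ^ (d * q) descendants in its lower corner of half side: this
keeps the closed cube of the descendant inside the half-open ancestor, as the
second conclusion says, and so the nested half-open cubes of a branch have a
common point.  The bound on B makes the expected number of bad tuples at most
half the number 2 ^ (d * p) of intermediate cells in a cell of S, so every
cell of S keeps at least half of them after one component of each bad tuple has
been discarded; a surplus is cut off for all cells of S to have equally many
descendants. *)
Lemma refine_avoiding (d n p q : nat) (S : seq (cell d))
    (B : seq {ffun 'I_n -> cell d}) :
  0 < n -> 0 < d -> 0 < p -> uniq S ->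
  size B <= 2 ^ (d * p - 1) * 2 ^ (d * q * n) ->
  exists S' : seq (cell d),
    [/\ uniq S',
        forall w, w \in S' -> forall a,
          (w a).+1 < (w a %/ 2 ^ (p + q.+1)).+1 * 2 ^ (p + q.+1),
        {in S' &, injective (coarsen q.+1)},
        (forall w, w \in S' -> coarsen (p + q.+1) w \in S) /\
        (forall u, u \in S ->
           count (fun w => coarsen (p + q.+1) w == u) S' = 2 ^ (d * p - 1)) &
        forall b : {ffun 'I_n -> cell d},
          (forall i, b i \in S') -> injective b -> b \notin B].
Proof.
move=> n0 d0 p0 uniqS leB.
pose P := (seq_sub S * {ffun 'I_d -> 'I_(2 ^ p)})%type.
pose Q := {ffun 'I_d -> 'I_(2 ^ q)}.
pose M := 2 ^ (d * p - 1).
have cQ : #|{: Q}| = 2 ^ (d * q).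
  by rewrite card_ffun !card_ord -expnM mulnC.
have cP : #|{: {ffun 'I_d -> 'I_(2 ^ p)}}| = 2 * M.
  by rewrite card_ffun !card_ord -expnM -expnS mulnC; congr (_ ^ _); lia.
pose g (x : P * Q) : cell d :=
  [ffun a => (val x.1.1 a * 2 ^ p + x.1.2 a) * 2 ^ q.+1 + x.2 a].
have ltQ (x : Q) a : x a < 2 ^ q.+1.
  by rewrite (leq_trans (ltn_ord _)) // leq_exp2l.
have g_mid x : coarsen q.+1 (g x) = [ffun a => val x.1.1 a * 2 ^ p + x.1.2 a].
  apply/ffunP => a; rewrite !ffunE divnMDl ?expn_gt0 //.
  by rewrite divn_small ?addn0.
have g_top x : coarsen (p + q.+1) (g x) = val x.1.1.
  rewrite addnC -coarsenD g_mid; apply/ffunP => a.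
  by rewrite !ffunE divnMDl ?expn_gt0 // divn_small ?addn0.
have g_mid_inj x y : coarsen q.+1 (g x) = coarsen q.+1 (g y) -> x.1 = y.1.
  move=> e; have e1 : x.1.1 = y.1.1.
    by apply: val_inj; rewrite -!g_top addnC -!coarsenD e.
  case: x y e e1 => [[u x] x'] [[v y] y'] /= + euv; rewrite -{v}euv => e.
  congr (_, _); apply/ffunP => a; apply: val_inj.
  by move: e; rewrite !g_mid => /ffunP/(_ a); rewrite !ffunE /= => /addnI.
have g_inj : injective g.
  move=> x y e; have e1 := g_mid_inj _ _ (congr1 (coarsen q.+1) e).
  case: x y e e1 => [x x'] [y y'] /= + exy; rewrite -{y}exy => e.
  congr (_, _); apply/ffunP => a; apply: val_inj.
  by move/ffunP: e => /(_ a); rewrite !ffunE /= => /addnI.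
pose lift (b : {ffun 'I_n -> P * Q}) := [ffun i => g (b i)].
have lift_inj : injective lift.
  move=> b b' /ffunP e; apply/ffunP => i; apply: g_inj.
  by have := e i; rewrite !ffunE.
pose bad := [set b : {ffun 'I_n -> P * Q} |
  injectiveb (fun i => (b i).1) && (lift b \in B)].
have [|||s les] := @random_choice P Q n bad M.
- by rewrite cQ expn_gt0.
- by move=> b; rewrite inE => /andP[/injectiveP].
- rewrite cQ -expnM; apply: leq_trans leB.
  rewrite cardE -(size_map lift); apply: uniq_leq_size.
    by rewrite map_inj_uniq ?enum_uniq.
  by move=> _ /mapP[b + ->]; rewrite mem_enum inE => /andP[].
pose i0 := Ordinal n0.
(* once these intermediate cells are discarded, no bad tuple survives *)
pose R := [set (b i0).1 | b : {ffun 'I_n -> P * Q} in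
  [set b in bad | [forall i, s (b i).1 == (b i).2]]].
have leR : #|R| <= M by apply: leq_trans les; apply: leq_imset_card.
pose T u := take M (enum [pred x | (u, x) \notin R]).
have sizeT u : size (T u) = M.
  rewrite size_takel // -cardE.
  have leRu : #|[pred x | (u, x) \in R]| <= M.
    apply: leq_trans leR.
    have : [set (u, x) | x in [set x | (u, x) \in R]] \subset R.
      by apply/fintype.subsetP => _ /imsetP[x + ->]; rewrite inE.
    move/subset_leq_card; rewrite card_imset; last by move=> x y [].
    by rewrite cardsE.
  rewrite -(leq_add2l #|[pred x | (u, x) \in R]|).
  rewrite -[leqRHS](_ : 2 * M = _); first by rewrite mulSn mul1n leq_add2r.
  by rewrite -cP -(cardC [pred x | (u, x) \in R]); congr addn; apply: eq_card.
have TR u x : x \in T u -> (u, x) \notin R.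
  by move=> /mem_take; rewrite mem_enum inE.
pose h u x := g ((u, x), s (u, x)).
have h_inj u x v y : h u x = h v y -> (u, x) = (v, y).
  by move=> /g_inj [-> ->].
pose S' := [seq h u x | u <- enum {: seq_sub S}, x <- T u].
have S'P w : w \in S' -> exists u x, x \in T u /\ w = h u x.
  by move=> /allpairsPdep[u [x [_ xT ->]]]; exists u, x.
have uniqS' : uniq S'.
  apply: allpairs_uniq_dep; first exact: enum_uniq.
    by move=> u _; rewrite take_uniq // enum_uniq.
  by move=> [u x] [v y] /= _ _ /h_inj [-> ->].
exists S'; split => //.
- move=> w /S'P[u [x [_ ->]]] a.
  have := g_top ((u, x), s (u, x)) => /ffunP/(_ a); rewrite ffunE => ->.
  rewrite !ffunE /=.
  have := ltn_ord (x a); have := ltn_ord (s (u, x) a).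
  rewrite expnD expnS; move: (val u a) (val (s _ a)) (val (x a)) => ? ? ? h1 h2.
  have : 0 < 2 ^ p by rewrite expn_gt0.
  nia.
- move=> w w' /S'P[u [x [_ ->]]] /S'P[v [y [_ ->]]] /g_mid_inj /= [-> ->] //.
- split=> [w /S'P[u [x [_ ->]]]|u uS]; first by rewrite g_top; apply: valP.
  pose u' : seq_sub S := SeqSub uS.
  rewrite -[RHS](sizeT u') -(size_map (h u')) -size_filter; apply: perm_size.
  apply: uniq_perm; first exact: filter_uniq.
    rewrite map_inj_in_uniq ?take_uniq ?enum_uniq // => x y _ _ /h_inj [//].
  move=> w; rewrite mem_filter; apply/andP/mapP => [[/eqP]|[x xT ->]].
    move=> e /S'P[v [x [xT ew]]]; move: e; rewrite ew g_top /= => e.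
    have -> : u' = v by apply: val_inj.
    by exists x.
  rewrite g_top eqxx; split => //; apply/allpairsPdep.
  by exists u', x; rewrite mem_enum.
- move=> b bS' b_inj; apply/negP => bB.
  have /fin_all_exists[y yP] i : exists y : P, y.2 \in T y.1 /\ b i = h y.1 y.2.
    by have /S'P[u [x [xT ->]]] := bS' i; exists (u, x).
  pose b' : {ffun 'I_n -> P * Q} := [ffun i => (y i, s (y i))].
  have eb i : g (b' i) = b i by rewrite ffunE (yP i).2 /h; case: (y i).
  have b'sel : b' \in [set b in bad | [forall i, s (b i).1 == (b i).2]].
    rewrite !inE -andbA; apply/and3P; split.
    - apply/injectiveP => i i'; rewrite !ffunE /= => e; apply: b_inj.
      by rewrite (yP i).2 (yP i').2 e.
    - by rewrite (_ : lift b' = b) //; apply/ffunP => i; rewrite ffunE eb.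
    - by apply/forallP => i; rewrite ffunE.
  have /negP[] := TR _ _ (yP i0).1; apply/imsetP; exists b' => //.
  by rewrite ffunE; case: (y i0).
Qed.

Local Open Scope classical_set_scope.
Local Open Scope ring_scope.

(** * Trees of cells *)

(** The arity m k depends on the stage alone; equal masses for the cells of
each stage are then additive along the tree. *)
Record cell_tree (d : nat) (lev : nat -> nat) (S : nat -> seq (cell d))
    (m : nat -> nat) : Prop := CellTree {
  tree_lev0 : lev 0%N = 0%N;
  tree_lev : forall k, (lev k < lev k.+1)%N;
  tree_root : S 0%N = [:: [ffun=> 0%N]];
  tree_uniq : forall k, uniq (S k);
  tree_arity_gt0 : forall k, (0 < m k)%N;
  tree_parent : forall k w,
    w \in S k.+1 -> coarsen (lev k.+1 - lev k) w \in S k;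
  tree_children : forall k u, u \in S k ->
    count (fun w => coarsen (lev k.+1 - lev k) w == u) (S k.+1) = m k
}.

Lemma count_partition (T : eqType) (V : eqType) (f : T -> V) (P : pred T)
    (Q : pred V) (s : seq T) (t : seq V) :
  uniq t -> {in s, forall x, f x \in t} ->
  (\sum_(v <- t | Q v) count (fun x => (f x == v) && P x) s)%N =
  count (fun x => Q (f x) && P x) s.
Proof.
move=> uniqt ft.
under eq_bigr do rewrite -sum1_count big_mkcond.
rewrite exchange_big -sum1_count [RHS]big_mkcond /=.
rewrite big_seq [RHS]big_seq; apply: eq_bigr => x xs.
rewrite big_mkcond (bigD1_seq (f x)) ?ft //= eqxx /= big1_seq ?addn0.
  by case: (Q (f x)).
by move=> v /andP[vf _]; rewrite eq_sym (negPf vf) /= if_same.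
Qed.

Section tree.
Variables (R : realType) (d : nat) (lev : nat -> nat) (S : nat -> seq (cell d)).
Variables (m : nat -> nat).
Hypothesis tree : cell_tree lev S m.

Local Notation anc k M := (coarsen (lev M - lev k)).

Lemma tree_lev_le k M : (k <= M)%N -> (lev k <= lev M)%N.
Proof.
move=> kM; apply: (@homo_leq _ lev leq) => // [|i]; first exact: leq_trans.
exact: ltnW (tree_lev tree i).
Qed.

Lemma tree_lev_ge k : (k <= lev k)%N.
Proof.
elim: k => // k ih; exact: leq_ltn_trans ih (tree_lev tree k).
Qed.

Lemma anc_trans i k M (w : cell d) : (i <= k)%N -> (k <= M)%N ->
  anc i k (anc k M w) = anc i M w.
Proof.
move=> ik kM; rewrite coarsenD; congr (coarsen _ w).
by have := tree_lev_le ik; have := tree_lev_le kM; lia.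
Qed.

Lemma anc_id k (w : cell d) : anc k k w = w.
Proof. by rewrite subnn coarsen0. Qed.

Lemma anc_mem k M w : (k <= M)%N -> w \in S M -> anc k M w \in S k.
Proof.
elim: M w => [|M ih] w; first by rewrite leqn0 => /eqP ->; rewrite anc_id.
rewrite leq_eqVlt => /predU1P[-> wS|]; first by rewrite anc_id.
rewrite ltnS => kM /(tree_parent tree) wS.
by rewrite -(anc_trans w kM (leqnSn M)); exact: ih.
Qed.

(** The mass of a set of cells of stage k can be computed at the next stage. *)
Lemma count_next (P : pred (cell d)) k :
  count (fun w => P (anc k k.+1 w)) (S k.+1) = (m k * count P (S k))%N.
Proof.
transitivity (count (fun w => P (anc k k.+1 w) && predT w) (S k.+1)).
  by apply: eq_count => w; rewrite andbT.
rewrite -(count_partition _ _ (tree_uniq tree k)); last first.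
  exact: tree_parent tree k.
rewrite -sum1_count big_distrr /= big_seq_cond [RHS]big_seq_cond.
apply: eq_bigr => u /andP[uS _]; rewrite muln1 -(tree_children tree uS).
by apply: eq_count => w; rewrite andbT.
Qed.

Lemma tree_size_next k : size (S k.+1) = (m k * size (S k))%N.
Proof. by have := count_next predT k; rewrite !count_predT. Qed.

Lemma tree_size_gt0 k : (0 < size (S k))%N.
Proof.
elim: k => [|k ih]; first by rewrite (tree_root tree).
by rewrite tree_size_next muln_gt0 (tree_arity_gt0 tree).
Qed.

Definition share M (P : pred (cell d)) : R :=
  (count P (S M))%:R / (size (S M))%:R.

Lemma tree_size_neq0 k : (size (S k))%:R != 0 :> R.
Proof. by rewrite pnatr_eq0 -lt0n tree_size_gt0. Qed.

Lemma share_ge0 M P : 0 <= share M P.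
Proof. by rewrite divr_ge0. Qed.

Lemma share_next M (P : pred (cell d)) :
  share M.+1 (fun w => P (anc M M.+1 w)) = share M P.
Proof.
rewrite /share count_next tree_size_next !natrM invfM mulrACA mulfV ?mul1r //.
by rewrite pnatr_eq0 -lt0n (tree_arity_gt0 tree).
Qed.

(** The mass of the part of v, a cell of stage k, that is in the blocked set B
of cells of stage kap.  The stage M at which it is computed does not matter as
long as it is not before k and kap (blocked_shareD). *)
Definition blocked_share kap (B : pred (cell d)) k v M : R :=
  share M (fun w => (anc k M w == v) && B (anc kap M w)).

Lemma blocked_shareD kap B k v M e : (k <= M)%N -> (kap <= M)%N ->
  blocked_share kap B k v (M + e) = blocked_share kap B k v M.
Proof.
move=> kM kapM; elim: e => [|e <-]; first by rewrite addn0.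
rewrite addnS /blocked_share -[RHS]share_next; congr (_%:R / _).
by apply: eq_count => w; rewrite !anc_trans // (leq_trans _ (leq_addr _ _)).
Qed.

(** Additivity of the blocked mass, which drives the descent. *)
Lemma blocked_share_children kap B k v M : (k < M)%N ->
  \sum_(u <- S k.+1 | anc k k.+1 u == v) blocked_share kap B k.+1 u M
  = blocked_share kap B k v M.
Proof.
move=> kM; rewrite -mulr_suml -natr_sum; congr (_%:R / _).
rewrite (count_partition _ (fun u => anc k k.+1 u == v)).
- by apply: eq_count => w; rewrite anc_trans.
- exact: tree_uniq tree _.
- by move=> w; apply: anc_mem.
Qed.

Lemma blocked_share_full kap (B : pred (cell d)) v : v \in S kap -> B v ->
  (size (S kap))%:R^-1 <= blocked_share kap B kap v kap.
Proof.
move=> vS Bv; rewrite ler_peMl ?invr_ge0 // ler1n -has_count.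
by apply/hasP; exists v => //; rewrite !anc_id eqxx.
Qed.

(** B j is a set of blocked cells of stage kap j, and share is the fraction
of that stage they occupy.  A cell v of stage k is good if the total blocked
mass in v is less than the mass of v.  The root is good by hypothesis.  A good
cell has a good child, since both masses are sums over the children.  A cell
in a blocked cell is not good, for one term of the sum already equals its
mass; so a branch of good cells meets no blocked cell. *)
Lemma escaping_branch (kap : nat -> nat) (B : nat -> pred (cell d)) :
  (\sum_(0 <= j <oo) (share (kap j) (B j))%:E < 1%:E)%E ->
  exists v : nat -> cell d,
    [/\ forall k, v k \in S k,
        forall k, anc k k.+1 (v k.+1) = v k
      & forall j, ~~ B j (v (kap j))].
Proof.
move=> lt1.
pose w j k v := blocked_share (kap j) (B j) k v (k + kap j).
have w0 j k v : (0 <= (w j k v)%:E)%E by rewrite lee_fin; exact: share_ge0.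
pose good k v := v \in S k /\
  (\sum_(0 <= j <oo) (w j k v)%:E < ((size (S k))%:R^-1)%:E)%E.
have good0 : good 0%N [ffun=> 0%N].
  split; first by rewrite (tree_root tree) inE.
  rewrite (tree_root tree) invr1; apply: le_lt_trans lt1.
  apply: lee_nneseries => [j _ _|j _]; first exact: w0.
  rewrite lee_fin /w add0n ler_wpM2r ?invr_ge0 // ler_nat.
  by apply: sub_count => z /andP[_]; rewrite anc_id.
have goodS k v : good k v -> exists u, good k.+1 u /\ anc k k.+1 u = v.
  move=> [vS ltv]; apply: contrapT => none.
  have : (\sum_(u <- S k.+1 | anc k k.+1 u == v)
      ((size (S k.+1))%:R^-1)%:E <= \sum_(0 <= j <oo) (w j k v)%:E)%E.
    have -> : (\sum_(0 <= j <oo) (w j k v)%:E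
       = \sum_(0 <= j <oo)
         \sum_(u <- S k.+1 | anc k k.+1 u == v) (w j k.+1 u)%:E)%E.
      apply: eq_eseriesr => j _; rewrite sumEFin; congr EFin.
      rewrite /w addSn blocked_share_children ?ltnS ?leq_addr //.
      by rewrite -[(k + kap j).+1]addn1 [RHS]blocked_shareD ?leq_addr ?leq_addl.
    rewrite (@nneseries_sum _ _ _ _ (fun u j => (w j k.+1 u)%:E)) //.
    rewrite big_seq_cond [leRHS]big_seq_cond.
    apply: lee_sum => u /andP[uS /eqP uv]; rewrite leNgt; apply/negP => ltu.
    by apply: none; exists u.
  apply/negP; rewrite -ltNge; apply: lt_le_trans ltv _.
  rewrite sumEFin lee_fin big_const_seq iter_addr_0 (tree_children tree vS).
  rewrite tree_size_next natrM invfM -[leRHS]mulr_natl mulrA mulfV ?mul1r //.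
  by rewrite pnatr_eq0 -lt0n (tree_arity_gt0 tree).
have [f fP] : {f : nat * cell d -> cell d & forall x, good x.1 x.2 ->
    good x.1.+1 (f x) /\ anc x.1 x.1.+1 (f x) = x.2}.
  apply: (@choice _ _ (fun (x : nat * cell d) (y : cell d) => good x.1 x.2 ->
    good x.1.+1 y /\ anc x.1 x.1.+1 y = x.2)) => -[k v].
  have [/goodS[u]|ng] := pselect (good k v); first by exists u.
  by exists v.
pose v := fix v k := if k is k'.+1 then f (k', v k') else [ffun=> 0%N].
have vgood k : good k (v k) by elim: k => // k ih; exact: (fP (k, v k) ih).1.
exists v; split => [k|k|j]; first exact: (vgood k).1.
  exact: (fP (k, v k) (vgood k)).2.
apply/negP => Bv; have [vS] := vgood (kap j); apply/negP; rewrite -leNgt.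
apply: (@le_trans _ _ (w j (kap j) (v (kap j)))%:E).
  by rewrite lee_fin /w blocked_shareD // blocked_share_full.
apply: le_trans (nneseries_lim_ge j.+1 _) => //.
by rewrite big_nat_recr //= leeDr // sume_ge0.
Qed.
End tree.

(** * Dyadic covers from the lower Minkowski dimension *)

Definition cell_of (R : realType) (d j : nat) (x : 'rV[R]_d) : cell d :=
  [ffun a => Num.truncn (2 ^+ j * x 0 a)].

(** The consequence of having lower Minkowski dimension at most alpha that is
used below; the covers are at dyadic scales instead of arbitrary ones. *)
Definition dyadically_thin (R : realType) (m : nat) (alpha : R)
    (K : set 'rV[R]_m) : Prop :=
  forall (eps : R) (J : nat), 0 < eps ->
  exists (j : nat) (B : seq (cell m)),
    [/\ (J <= j)%N, (size B)%:R <= 2 `^ (j%:R * (alpha + eps))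
      & forall x, K x -> cell_of j x \in B].

Definition cube_at (R : realType) (m : nat) (l : R) (a : 'rV[int]_m) :
    set 'rV[R]_m :=
  [set x | forall j, l * (a 0 j)%:~R <= x 0 j < l * (a 0 j)%:~R + l].

Lemma compact_coord_bounded (R : realType) (m : nat) (K : set 'rV[R]_m) :
  compact K -> exists M : R, forall x, K x -> forall j, `|x 0 j| <= M.
Proof.
move=> /compact_bounded[M [_ bM]]; exists (M + 1) => x Kx j.
apply: le_trans (bM (M + 1) _ x Kx); last by rewrite ltrDl.
rewrite [leRHS]/Num.norm /= mx_normrE; apply/bigmax_geP; right => /=.
by exists (0, j).
Qed.

Lemma finite_cubes_meeting (R : realType) (m : nat) (l : R) (K : set 'rV[R]_m) :
  0 < l -> compact K -> finite_set (cubes_meeting l K).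
Proof.
move=> l0 /compact_coord_bounded[M bM].
pose N := (Num.truncn (M / l)).+2.
pose f (e : {ffun 'I_m -> 'I_(2 * N).+1}) : set 'rV[R]_m :=
  cube_at l (\row_j ((e j)%:Z - N%:Z)).
apply: (@sub_finite_set _ _ (f @` setT)); last exact/finite_image/finite_finset.
move=> I [[a Ia] [x []]]; rewrite {1}Ia => xI /bM Kx.
have aN j : (- N%:Z <= a 0 j <= N%:Z).
  have := xI j; have := Kx j; rewrite ler_norml => /andP[h1 h2] /andP[h3 h4].
  have Ml : M < l * N%:R - l.
    have := truncnS_gt (M / l); rewrite ltr_pdivrMr // => h.
    rewrite /N; move: h; rewrite -(natr1 (_.+1)); nra.
  rewrite -!(ler_int R) rmorphN /= -!pmulrn.
  rewrite -(ler_pM2l l0) -[X in _ && X](ler_pM2l l0) mulrN.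
  by apply/andP; split; lra.
exists ([ffun j : 'I_m => inord `|(a 0 j + N%:Z)%R|%N]
  : {ffun 'I_m -> 'I_(2 * N).+1}) => //.
rewrite Ia /f -/(cube_at l a); congr cube_at.
apply/rowP => j; rewrite !mxE ffunE inordK; last by have := aN j; lia.
by have := aN j; lia.
Qed.

Lemma count_of_lne_ratio (R : realType) (N : nat) (l c : R) : 0 < l < 1 ->
  (((lne N%:R%:E) * ((ln (1 / l))^-1)%:E)%E < c%:E)%E ->
  N%:R <= (l^-1) `^ c.
Proof.
move=> /andP[l0 l1]; have [->|N0] := posnP N; first by rewrite powR_ge0.
have lnl : 0 < ln (1 / l) by rewrite ln_gt0 // div1r invf_gt1.
rewrite lne_EFin ?ltr0n // -EFinM lte_fin ltr_pdivrMr // => h.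
have l'0 : 0 < l^-1 by rewrite invr_gt0.
rewrite -ler_ln ?posrE ?powR_gt0 ?ltr0n // ln_powR; apply: ltW.
by move: h; rewrite div1r.
Qed.

Lemma pow2_eventually_ge (R : realType) (x c : R) : 0 < c ->
  exists J, forall j, (J <= j)%N -> x <= 2 `^ (j%:R * c).
Proof.
move=> c0; have [x0|x0] := leP x 0.
  by exists 0%N => j _; rewrite (le_trans x0) ?powR_ge0.
have ln2 : 0 < ln (2 : R) by rewrite ln_gt0 // ltr1n.
exists (Num.truncn (ln x / (c * ln 2))).+1 => j Jj.
rewrite -ler_ln ?posrE ?powR_gt0 // ln_powR -mulrA -ler_pdivrMr ?mulr_gt0 //.
by apply: ltW; rewrite (lt_le_trans (truncnS_gt _)) // ler_nat.
Qed.

Lemma dyadic_scale (R : realType) (l : R) : 0 < l < 1 ->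
  exists j, 2 ^- j.+1 <= l < 2 ^- j.
Proof.
move=> /andP[l0 l1].
have exj : exists j, 2 ^- j <= l.
  have [J /(_ J (leqnn J))] := pow2_eventually_ge l^-1 (@ltr01 R).
  rewrite mulr1 powR_mulrn // => le; exists J.
  by rewrite -[leRHS]invrK lef_pV2 ?posrE ?invr_gt0 ?exprn_gt0.
have := @ex_minnP (fun j => 2 ^- j <= l) exj.
case=> -[|j] jl jmin; first by move: jl; rewrite expr0 invr1 leNgt l1.
by exists j; rewrite jl ltNge; apply/negP => /jmin; rewrite ltnn.
Qed.

(** The definition of the dimension gives a real scale l with few cubes.
Take j with l < 2 * 2 ^ - j <= 2 * l: a cube of side l is less than two
dyadic sides long, so each coordinate index takes at most three values on it.
The resulting factor 3 ^ m is less than 2 ^ (j * (eps / 2)) at fine scales. *)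
Lemma compact_dyadically_thin (R : realType) (m : nat) (alpha : R)
    (K : set 'rV[R]_m) : 0 <= alpha ->
  compact K -> (lower_minkowski_dim K <= alpha%:E)%E ->
  dyadically_thin alpha K.
Proof.
move=> alpha0 cK dimK eps J eps0.
have c2 : 0 < eps / 2 by rewrite divr_gt0.
(* beyond this level the constant 3 ^ m is absorbed in the exponent *)
have [J' J'P] : exists J', forall j, (J' <= j)%N ->
    (3 ^ m)%:R <= 2 `^ (j%:R * (eps / 2)) :> R.
  exact: pow2_eventually_ge.
pose J0 := maxn J J'.
have [l [/andP[l0 lJ] ltl]] : exists l : R, 0 < l < 2 ^- J0.+1 /\
    ((lne (#|` fset_set (cubes_meeting l K)|%:R)%:E
      * ((ln (1 / l))^-1)%:E)%E < (alpha + eps / 2)%:E)%E.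
  apply: contrapT => none; move: dimK; apply/negP; rewrite -ltNge.
  apply: (@lt_le_trans _ _ (alpha + eps / 2)%:E).
    by rewrite lte_fin ltrDl.
  rewrite /lower_minkowski_dim limf_einfE.
  apply: le_trans (ereal_sup_ubound _); last first.
    exists [set l | 0 < l < 2 ^- J0.+1] => //=.
    near=> l; apply/andP; split; near: l; first exact: nbhs_right_gt.
    by apply: nbhs_right_lt; rewrite invr_gt0 exprn_gt0.
  apply: le_ereal_inf_tmp => _ [l lJ <-]; rewrite leNgt; apply/negP => ltl.
  by apply: none; exists l.
have l1 : l < 1.
  by rewrite (lt_le_trans lJ) // -exprVn exprn_ile1 // invf_le1 // ler1n.
have [j' /andP[]] := @dyadic_scale R l (introT andP (conj l0 l1)).
set j := j'.+1 => jl lj.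
have l2j : 2 ^+ j * l < 2.
  have : 2 ^+ j' * l < 1 by rewrite mulrC -ltr_pdivlMr ?exprn_gt0 // div1r.
  by rewrite /j exprS -mulrA; lra.
have Jj : (J0 <= j)%N.
  rewrite leqNgt; apply/negP => jJ.
  have h : 2 ^- J0.+1 <= 2 ^- j :> R.
    by rewrite lef_pV2 ?posrE ?exprn_gt0 // ler_weXn2l ?ler1n // ltnW // ltnW.
  by have := lt_le_trans (le_lt_trans jl lJ) h; rewrite ltxx.
have := count_of_lne_ratio _ ltl; rewrite l0 l1 => /(_ isT).
set cubes := fset_set _ => leN.
have finc : finite_set (cubes_meeting l K) by exact: finite_cubes_meeting.
have [A AP] : {A : set 'rV[R]_m -> 'rV[int]_m &
    forall I, cubes_meeting l K I -> I = cube_at l (A I)}.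
  apply: (@choice _ _ (fun I a => cubes_meeting l K I -> I = cube_at l a)) => I.
  have [[[a ->] _]|nI] := pselect (cubes_meeting l K I); first by exists a.
  by exists 0 => /nI.
pose g (I : set 'rV[R]_m) (e : {ffun 'I_m -> 'I_3}) : cell m :=
  [ffun a => (Num.truncn (2 ^+ j * (l * (A I 0 a)%:~R)) + e a)%N].
exists j, [seq g Q e | Q <- enum_fset cubes, e <- enum {: {ffun 'I_m -> 'I_3}}].
split.
- by rewrite (leq_trans _ Jj) // leq_maxl.
- rewrite size_allpairs -cardE card_ffun !card_ord natrM.
  have -> : alpha + eps = alpha + eps / 2 + eps / 2 by lra.
  rewrite mulrDr powRD; last by rewrite pnatr_eq0 implybT.
  apply: ler_pM => //; last by apply: J'P; rewrite (leq_trans _ Jj) // leq_maxr.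
  apply: le_trans leN _; rewrite powRrM powR_mulrn //.
  apply: ge0_ler_powR; rewrite ?nnegrE ?invr_ge0 ?exprn_ge0 //; try lra.
  by rewrite -[leRHS]invrK lef_pV2 ?posrE // invr_gt0 exprn_gt0.
- move=> x Kx.
  pose a0 : 'rV[int]_m := \row_a Num.floor (x 0 a / l).
  have xI : cube_at l a0 x.
    move=> a; rewrite mxE; have := floor_itv (x 0 a / l).
    rewrite ler_pdivlMr // ltr_pdivrMr // intrD => /andP[h1 h2].
    by apply/andP; split; lra.
  have Im : cubes_meeting l K (cube_at l a0) by split; [exists a0|exists x].
  have eI := AP _ Im; move: xI; rewrite {1}eI => xI.
  have e3 a : (Num.truncn (2 ^+ j * x 0 a)%R
      - Num.truncn (2 ^+ j * (l * (A (cube_at l a0) 0 a)%:~R))%R < 3)%N.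
    have /andP[_ h] := xI a.
    set z := 2 ^+ j * (l * _); rewrite ltnS leq_subLR truncn_le_nat.
    have := truncnS_gt z; rewrite -addnS natrD -(natr1 (Num.truncn z)).
    have : 2 ^+ j * x 0 a < z + 2 ^+ j * l.
      by rewrite -mulrDr ltr_pM2l ?exprn_gt0.
    lra.
  apply/allpairsPdep; exists (cube_at l a0), [ffun a => Ordinal (e3 a)]; split.
  + by rewrite in_fset_set // inE.
  + by rewrite mem_enum.
  + apply/ffunP => a; rewrite !ffunE /= subnKC //; apply: le_truncn.
    by rewrite ler_pM2l ?exprn_gt0 //; have /andP[] := xI a.
Unshelve. all: by end_near.
Qed.

(** * Cells met by a set of given diameter *)

Lemma truncn_divn_exp2 (R : realType) (e : nat) (y : R) :
  (Num.truncn (2 ^+ e * y)%R %/ 2 ^ e)%N = Num.truncn y.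
Proof.
have e0 : 0 < 2 ^+ e :> R by rewrite exprn_gt0.
have [y0|y0] := ltP y 0.
  have /eqP-> : Num.truncn y == 0%N.
    by rewrite -leqn0 truncn_le_nat; apply: lt_trans y0 _.
  have /eqP-> : Num.truncn (2 ^+ e * y) == 0%N.
    rewrite -leqn0 truncn_le_nat; apply: lt_trans (ltr01 : 0 < 1 :> R).
    by rewrite pmulr_rlt0.
  by rewrite div0n.
apply/eqP; rewrite eqn_leq; apply/andP; split.
  rewrite -ltnS ltn_divLR ?expn_gt0 // truncn_lt_nat ?mulr_ge0 // ?ltW //.
  by rewrite natrM natrX mulrC ltr_pM2r // truncnS_gt.
rewrite leq_divRL ?expn_gt0 // truncn_ge_nat ?mulr_ge0 //.
by rewrite natrM natrX mulrC ler_pM2l // truncn_le.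
Qed.

Lemma coarsen_cell_of (R : realType) (d i j : nat) (x : 'rV[R]_d) :
  (i <= j)%N -> coarsen (j - i) (cell_of j x) = cell_of i x.
Proof.
move=> ij; apply/ffunP => a; rewrite !ffunE -{1}(subnK ij) exprD -mulrA.
exact: truncn_divn_exp2.
Qed.

Definition meets (R : realType) (d j : nat) (A : set 'rV[R]_d) :
    pred (cell d) :=
  fun v => `[< exists2 x, A x & cell_of j x = v >].

(** Coarsened to level i, the cells are counted by the volume of a cube of side
about t, rounded up to level i; and coarsening loses no cell of s. *)
Lemma few_cells (R : realType) (d i j : nat) (t : R) (A : set 'rV[R]_d)
    (s : seq (cell d)) :
  (i <= j)%N -> 0 < t ->
  (forall x y, A x -> A y -> forall a, x 0 a - y 0 a <= t) ->
  uniq s -> {in s &, injective (coarsen (j - i))} ->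
  (count (meets j A) s)%:R <= (4 * Num.max 1 (2 ^+ i * t)) ^+ d.
Proof.
move=> ij t0 At us injs.
have [A0|/set0P[x0 Ax0]] := eqVneq A set0.
  rewrite (eq_count (a2 := pred0)) ?count_pred0.
    by rewrite exprn_ge0 // mulr_ge0 // le_max ler01.
  by move=> v; apply/asboolP => -[x]; rewrite A0.
have i0 : 0 < 2 ^+ i :> R by rewrite exprn_gt0.
pose lo (a : 'I_d) : nat := Num.truncn (2 ^+ i * (x0 0 a - t)).
pose L := (Num.truncn (2 * (2 ^+ i * t))).+1.
have eL : L.+1%:R = (Num.truncn (2 * (2 ^+ i * t)))%:R + 1 + 1 :> R.
  by rewrite !natr1.
have leL : L.+1%:R <= 4 * Num.max 1 (2 ^+ i * t).
  have : (Num.truncn (2 * (2 ^+ i * t)))%:R <= 2 * (2 ^+ i * t).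
    by rewrite truncn_le !mulr_ge0 // ltW.
  have : 1 <= Num.max 1 (2 ^+ i * t) by rewrite le_max lexx.
  have : 2 ^+ i * t <= Num.max 1 (2 ^+ i * t) by rewrite le_max lexx orbT.
  by rewrite eL; lra.
apply: (@le_trans _ _ (L.+1%:R ^+ d)); last first.
  by rewrite lerXn2r ?nnegrE // (le_trans _ leL).
pose h (v : cell d) : {ffun 'I_d -> 'I_L.+1} :=
  [ffun a => inord (coarsen (j - i) v a - lo a)].
have range v : meets j A v ->
    forall a, (lo a <= coarsen (j - i) v a <= lo a + L)%N.
  move=> /asboolP[x Ax <-] a; rewrite coarsen_cell_of // ffunE.
  have h1 := At _ _ Ax0 Ax a; have h2 := At _ _ Ax Ax0 a.
  apply/andP; split; first by apply: le_truncn; rewrite ler_pM2l //; lra.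
  rewrite truncn_le_nat -addnS natrD eL.
  have := truncnS_gt (2 ^+ i * (x0 0 a - t)); rewrite -/(lo a) -natr1.
  have := truncnS_gt (2 * (2 ^+ i * t)); rewrite -natr1.
  have : 2 ^+ i * x 0 a <= 2 ^+ i * (x0 0 a - t) + 2 * (2 ^+ i * t).
    rewrite [leRHS](_ : _ = 2 ^+ i * (x0 0 a + t)); last by ring.
    by rewrite ler_pM2l //; lra.
  by lra.
rewrite -natrX ler_nat -size_filter.
have -> : (L.+1 ^ d)%N = size (enum {: {ffun 'I_d -> 'I_L.+1}}).
  by rewrite -cardE card_ffun !card_ord.
rewrite -(size_map h).
apply: uniq_leq_size; last by move=> z _; rewrite mem_enum.
rewrite map_inj_in_uniq ?filter_uniq // => v w.
rewrite !mem_filter => /andP[/range mv vs] /andP[/range mw ws] /ffunP e.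
apply: injs => //; apply/ffunP => a; have := e a; rewrite !ffunE.
move/(congr1 (@nat_of_ord _)).
have := mv a; have := mw a; rewrite !ffunE => ? ?.
rewrite !inordK; lia.
Qed.

(** * Hausdorff measure of the limit set *)

Definition limit_set (R : realType) (d : nat) (lev : nat -> nat)
    (S : nat -> seq (cell d)) : set 'rV[R]_d :=
  [set x : 'rV[R]_d | (forall a, 0 <= x 0 a < 1) /\
    forall k, cell_of (lev k) x \in S k].

(** The strict inequality places the closed interval of v k.+1 inside the
half-open interval of v k, so the supremum of the left ends lies in all of
them. *)
Lemma nested_point (R : realType) (lev v : nat -> nat) :
  (forall k, (lev k <= lev k.+1)%N) ->
  (forall k, (v k.+1 %/ 2 ^ (lev k.+1 - lev k))%N = v k) ->
  (forall k, ((v k.+1).+1 < (v k).+1 * 2 ^ (lev k.+1 - lev k))%N) ->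
  exists y : R, forall k, (v k)%:R <= 2 ^+ lev k * y < (v k).+1%:R.
Proof.
move=> levS vS v1S.
have e0 k : 0 < 2 ^+ lev k :> R by rewrite exprn_gt0.
have levE k : 2 ^+ lev k.+1 = 2 ^+ (lev k.+1 - lev k) * 2 ^+ lev k :> R.
  by rewrite -exprD subnK.
pose lo k : R := (v k)%:R / 2 ^+ lev k.
pose hi k : R := (v k).+1%:R / 2 ^+ lev k.
have loS k : lo k <= lo k.+1.
  rewrite /lo ler_pdivlMr // mulrAC ler_pdivrMr // levE mulrA ler_pM2r //.
  by rewrite -natrX -natrM ler_nat -(vS k) leq_trunc_div.
have hiS k : hi k.+1 < hi k.
  rewrite /hi ltr_pdivlMr // mulrAC ltr_pdivrMr // levE mulrA ltr_pM2r //.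
  by rewrite -natrX -natrM ltr_nat.
have lo_mono : {homo lo : i j / (i <= j)%N >-> i <= j}.
  by apply: homo_leq => [//|i j k|//]; exact: le_trans.
have hi_mono : {homo hi : i j / (i <= j)%N >-> j <= i}.
  apply: homo_leq => [//|i j k ji kj|i]; first exact: le_trans kj ji.
  exact: ltW.
have lohi i j : lo i <= hi j.
  apply: le_trans (lo_mono _ _ (leq_maxl i j)) _.
  apply: le_trans (hi_mono _ _ (leq_maxr i j)).
  by rewrite ler_pM2r ?invr_gt0 // ler_nat.
have supE : has_sup [set lo k | k in setT].
  by split; [exists (lo 0%N), 0%N|exists (hi 0%N) => _ [k _ <-]].
exists (sup [set lo k | k in setT]) => k; apply/andP; split.
  by rewrite mulrC -ler_pdivrMr //; apply: sup_ubound supE.2 _ _; exists k.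
rewrite mulrC -ltr_pdivlMr //; apply: le_lt_trans (hiS k).
by apply: ge_sup supE.1 _ => _ [j _ <-].
Qed.

Lemma edist_coord (R : realType) (d : nat) (x y : 'rV[R]_d) a :
  x 0 a - y 0 a <= Defs.edist x y.
Proof.
apply: le_trans (ler_norm _) _; rewrite -sqrtr_sqr; apply: ler_wsqrtr.
by rewrite (bigD1 a) //= lerDl sumr_ge0 // => i _; rewrite sqr_ge0.
Qed.

Lemma diam_coord (R : realType) (d : nat) (A : set 'rV[R]_d) (t : R) :
  (diam A <= t%:E)%E ->
  forall x y, A x -> A y -> forall a, x 0 a - y 0 a <= t.
Proof.
move=> dA x y Ax Ay a; apply: le_trans (edist_coord x y a) _.
rewrite -lee_fin; apply: le_trans dA; rewrite /diam le_max; apply/orP; right.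
by apply: ereal_sup_ubound; exists (x, y).
Qed.

Lemma diam_ge0 (R : realType) (d : nat) (A : set 'rV[R]_d) : (0 <= diam A)%E.
Proof. by rewrite /diam le_max lexx. Qed.

Lemma diam_pow_ge0 (R : realType) (d : nat) s (A : set 'rV[R]_d) :
  (0 <= diam_pow s A)%E.
Proof. by rewrite /diam_pow; case: ifP => // _; rewrite poweR_ge0. Qed.

Section limit.
Variables (R : realType) (d : nat) (lev mid m : nat -> nat).
Variable (S : nat -> seq (cell d)).
Hypothesis tree : cell_tree lev S m.
Hypothesis mid_lev : forall k, (lev k < mid k <= lev k.+1)%N.
Hypothesis mE : forall k, m k = (2 ^ (d * (mid k - lev k) - 1))%N.
Hypothesis mid_inj : forall k,
  {in S k.+1 &, injective (coarsen (lev k.+1 - mid k))}.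
(* the closed cube of a child lies in the half-open cube of its parent *)
Hypothesis inner : forall k w, w \in S k.+1 -> forall a, ((w a).+1 <
  (w a %/ 2 ^ (lev k.+1 - lev k)).+1 * 2 ^ (lev k.+1 - lev k))%N.
Hypothesis d_gt0 : (0 < d)%N.

Lemma branch_point (v : nat -> cell d) : (forall k, v k \in S k) ->
  (forall k, coarsen (lev k.+1 - lev k) (v k.+1) = v k) ->
  exists2 x : 'rV[R]_d, limit_set lev S x & forall k, cell_of (lev k) x = v k.
Proof.
move=> vS vP.
have vE k a : (v k.+1 a %/ 2 ^ (lev k.+1 - lev k))%N = v k a.
  by rewrite -(vP k) ffunE.
have /choice[y yP] : forall a : 'I_d, exists y : R,
    forall k, (v k a)%:R <= 2 ^+ lev k * y < (v k a).+1%:R.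
  move=> a; apply: nested_point => // k; first exact: ltnW (tree_lev tree k).
  by have := inner (vS k.+1) a; rewrite vE.
have xv k : cell_of (lev k) (\row_a y a) = v k.
  by apply/ffunP => a; rewrite ffunE mxE; apply: truncn_def.
exists (\row_a y a) => //; split => [a|k]; last by rewrite xv.
have := yP a 0%N; have := vS 0%N; rewrite (tree_root tree) inE => /eqP ->.
by rewrite (tree_lev0 tree) expr0 mul1r ffunE mxE.
Qed.

Variables (s C : R).
Hypothesis s_bnd : 0 <= s <= d%:R.
(* the stages are as numerous as in a set of dimension s *)
Hypothesis sizeS : forall k, 2 `^ ((lev k)%:R * s) <= C * (size (S k))%:R.

(** The Frostman estimate.  Let k + 1 be the first stage with cells of side at
most t.  If t is at least the side 2 ^ - mid k, then about
(2 ^ mid k * t) ^ d cells of stage k.+1 meet A, each of mass about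
(2 ^ lev k / 2 ^ mid k) ^ d / #(S k), and the total is about
(2 ^ lev k * t) ^ d / #(S k).  As 2 ^ lev k * t < 1 and s <= d, this is at most
(2 ^ lev k * t) ^ s / #(S k), hence O(t ^ s).  If t is smaller, then a bounded
number of cells meet A, each of mass O((2 ^ - lev k.+1) ^ s), which is
O(t ^ s). *)
Lemma ball_share (t : R) (A : set 'rV[R]_d) : 0 < t < 1 ->
  (forall x y, A x -> A y -> forall a, x 0 a - y 0 a <= t) ->
  exists k, share R S k (meets (lev k) A) <= 2 * 4 ^+ d * C * t `^ s.
Proof.
move=> /andP[t0 t1] At; have /andP[s0 sd] := s_bnd.
have exk : exists k, 2 ^- lev k <= t.
  have [J /(_ J (leqnn J))] := pow2_eventually_ge t^-1 (@ltr01 R).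
  rewrite mulr1 powR_mulrn // => le; exists J.
  rewrite -[leRHS]invrK lef_pV2 ?posrE ?invr_gt0 ?exprn_gt0 //.
  apply: le_trans le _; rewrite ler_weXn2l ?ler1n //.
  exact: (tree_lev_ge tree).
have := @ex_minnP (fun k => 2 ^- lev k <= t) exk.
move=> [[|k] kt kmin].
  have := le_lt_trans kt t1.
  by rewrite (tree_lev0 tree) expr0 invr1 ltxx.
have tk : t < 2 ^- lev k by rewrite ltNge; apply/negP => /kmin; rewrite ltnn.
have /andP[ki ij] := mid_lev k; set i := mid k in ki ij.
exists k.+1; rewrite /share.
have := few_cells ij t0 At (tree_uniq tree _) (@mid_inj k).
set c := count _ _ => lec.
have N0 j : 0 < (size (S j))%:R :> R by rewrite ltr0n (tree_size_gt0 tree).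
have c4 : 0 <= 4 ^+ d :> R by rewrite exprn_ge0.
have C0 : 0 < C.
  rewrite -(pmulr_lgt0 _ (N0 0%N)); apply: lt_le_trans (sizeS 0).
  by rewrite powR_gt0.
have t_s : 0 <= t `^ s by rewrite powR_ge0.
have [T1|/ltW T1] := leP 1 (2 ^+ i * t).
  move: lec; rewrite max_r // => lec.
  pose u := 2 ^+ lev k * t.
  have u0 : 0 < u by rewrite mulr_gt0 ?exprn_gt0.
  have u1 : u <= 1.
    by rewrite /u mulrC -ler_pdivlMr ?exprn_gt0 // div1r ltW.
  have eT : (2 ^+ i * t) ^+ d = 2 * (m k)%:R * u ^+ d.
    rewrite -{1}(subnK (ltnW ki)) exprD -mulrA -/u exprMn; congr (_ * _).
    have dp : (0 < d * (i - lev k))%N by rewrite muln_gt0 d_gt0 subn_gt0.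
    have -> : 2 * (m k)%:R = (2 ^ (d * (i - lev k)))%:R :> R.
      by rewrite mE -[2]/(2%:R) -natrM -expnS subn1 prednK.
    by rewrite natrX mulnC exprM.
  have us : u ^+ d <= C * (size (S k))%:R * t `^ s.
    apply: (@le_trans _ _ (u `^ s)).
      by rewrite -(powR_mulrn d (ltW u0)) ger_powR // u0.
    rewrite powRM ?exprn_ge0 // ?(ltW t0) // -powR_mulrn // -powRrM.
    by rewrite ler_wpM2r.
  rewrite (tree_size_next tree) natrM ler_pdivrMr; last first.
    by rewrite mulr_gt0 // ltr0n (tree_arity_gt0 tree).
  apply: le_trans lec _; rewrite exprMn eT.
  apply: (@le_trans _ _
    (4 ^+ d * (2 * (m k)%:R * (C * (size (S k))%:R * t `^ s)))).
    by rewrite ler_wpM2l // ler_wpM2l // mulr_ge0.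
  by rewrite le_eqVlt; apply/orP; left; apply/eqP; ring.
move: lec; rewrite max_l // mulr1 => lec.
rewrite ler_pdivrMr //; apply: le_trans lec _.
have : 1 <= C * t `^ s * (size (S k.+1))%:R.
  rewrite mulrAC; apply: le_trans (ler_wpM2r t_s (sizeS k.+1)).
  rewrite powRrM powR_mulrn // -powRM ?exprn_ge0 ?(ltW t0) //.
  apply: (@le_trans _ _ (1 `^ s)); first by rewrite powR1.
  apply: ge0_ler_powR; rewrite ?nnegrE ?mulr_ge0 ?exprn_ge0 ?(ltW t0) //.
  by rewrite mulrC -ler_pdivrMr ?exprn_gt0 // div1r.
move=> h; rewrite -[leLHS]mulr1.
apply: (@le_trans _ _ (4 ^+ d * (2 * (C * t `^ s * (size (S k.+1))%:R)))).
  by rewrite ler_wpM2l //; lra.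
by rewrite le_eqVlt; apply/orP; left; apply/eqP; ring.
Qed.

Local Notation C' := (2 * 4 ^+ d * C).

Lemma C_ge1 : 1 <= C.
Proof.
have := sizeS 0; rewrite (tree_lev0 tree) (tree_root tree) mul0r powRr0.
by rewrite mulr1.
Qed.

(** The error eta is needed because a point has diameter 0 but meets a cell
of every stage.  Sets with diam ^ s at least 1, among them all nonempty sets
when s = 0, may block the whole tree. *)
Lemma block_set (A : set 'rV[R]_d) (eta : R) : 0 < eta ->
  exists (k : nat) (B : pred (cell d)),
    (forall x, A x -> B (cell_of (lev k) x)) /\
    ((share R S k B)%:E <= C'%:E * diam_pow s A + eta%:E)%E.
Proof.
move=> eta0; have C1 := C_ge1; have /andP[s0 sd] := s_bnd.
have C'1 : 1 <= C'.
  have : 1 <= 4 ^+ d :> R by rewrite exprn_ege1 // ler1n.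
  by nra.
have [->|A0] := eqVneq A set0.
  exists 0%N, pred0; split => //.
  by rewrite /share count_pred0 mul0r /diam_pow eqxx mule0 add0e lee_fin ltW.
have [big|small] := leP 1%E (diam_pow s A).
  exists 0%N, predT; split => //.
  rewrite /share count_predT divff ?(tree_size_neq0 R tree) //.
  apply: (@le_trans _ _ (C'%:E * 1)%E); first by rewrite mule1 lee_fin.
  apply: (@le_trans _ _ (C'%:E * diam_pow s A)%E); last first.
    by rewrite leeDl // lee_fin ltW.
  by rewrite lee_pmul2l // lte_fin; lra.
move: small; rewrite /diam_pow (negPf A0) => small.
have s_gt0 : 0 < s.
  rewrite lt_neqAle s0 andbT; apply/eqP => e.
  by move: small; rewrite -e poweRe0 ltxx.
have blockP t : 0 < t < 1 -> (diam A <= t%:E)%E ->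
    exists k, (forall x, A x -> meets (lev k) A (cell_of (lev k) x)) /\
      share R S k (meets (lev k) A) <= C' * t `^ s.
  move=> t01 /diam_coord dA.
  have [k kP] := ball_share t01 dA.
  by exists k; split => // x Ax; apply/asboolP; exists x.
have := diam_ge0 A; move: small blockP; case: (diam A) => [t| |] //; last first.
  by rewrite poweRyr ?gt_eqF.
rewrite poweR_EFin lte_fin lee_fin => small blockP.
rewrite le_eqVlt => /predU1P[t0|t0].
  (* any small positive t' may stand for the diameter 0 of a point *)
  pose t' := Num.min 2^-1 ((eta / C') `^ s^-1).
  have e0 : 0 < eta / C' by rewrite divr_gt0 //; lra.
  have t'0 : 0 < t' by rewrite lt_min invr_gt0 ltr0n powR_gt0.
  have [||k [kA kS]] := blockP t'.
  - by rewrite t'0 gt_min; apply/orP; left; rewrite invf_lt1 // ltr1n.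
  - by rewrite lee_fin -t0 ltW.
  - exists k, (meets (lev k) A); split => //.
    rewrite -t0 powR0 ?gt_eqF // mule0 add0e lee_fin; apply: le_trans kS _.
    rewrite -ler_pdivlMl; last by lra.
    rewrite mulrC; apply: (@le_trans _ _ (((eta / C') `^ s^-1) `^ s)).
      apply: ge0_ler_powR; rewrite ?nnegrE ?powR_ge0 ?(ltW t'0) //.
      by rewrite ge_min lexx orbT.
    by rewrite -powRrM mulVf ?gt_eqF // powRr1 // ltW.
have t1 : t < 1.
  rewrite ltNge; apply/negP => t1; move: small; apply/negP; rewrite -leNgt.
  apply: (@le_trans _ _ (1 `^ s)); first by rewrite powR1.
  by apply: ge0_ler_powR; rewrite ?nnegrE // ltW.
have [||k [kA kS]] := blockP t; rewrite ?t0 ?lexx //.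
exists k, (meets (lev k) A); split => //.
by rewrite -EFinM -EFinD lee_fin; apply: le_trans kS _; rewrite lerDl ltW.
Qed.

Lemma hausdorff_measure_limit_neq0 :
  hausdorff_measure s (@limit_set R d lev S) <> 0%E.
Proof.
move=> H0; have C1 := C_ge1.
have C'1 : 1 <= C'.
  have : 1 <= 4 ^+ d :> R by rewrite exprn_ege1 // ler1n.
  by nra.
have : (hausdorff_premeasure s 1 (@limit_set R d lev S) < ((4 * C')^-1)%:E)%E.
  apply: (@le_lt_trans _ _ 0%E); last by rewrite lte_fin invr_gt0; lra.
  by rewrite -H0; apply: ereal_sup_ubound; exists 1 => //; exact: ltr01.
move=> /ereal_inf_lt[_ [U [cov _] <-] ltU].
(* the diameters and the errors eta use at most 1 / 4 each of the mass 1 *)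
have eta0 j : 0 < 4^-1 / (2 ^ j.+1)%:R :> R.
  by rewrite divr_gt0 // ltr0n expn_gt0.
have /choice[f fP] : forall j, exists kB : nat * pred (cell d),
    (forall x, U j x -> kB.2 (cell_of (lev kB.1) x)) /\
    ((share R S kB.1 kB.2)%:E
       <= C'%:E * diam_pow s (U j) + (4^-1 / (2 ^ j.+1)%:R)%:E)%E.
  by move=> j; have [k [B kB]] := block_set (U j) (eta0 j); exists (k, B).
have [|v [vS vP vB]] := @escaping_branch R d lev S m tree
    (fun j => (f j).1) (fun j => (f j).2).
  apply: (@le_lt_trans _ _ (\sum_(0 <= j <oo)
      (C'%:E * diam_pow s (U j) + (4^-1 / (2 ^ j.+1)%:R)%:E))%E).
    apply: lee_nneseries => [j _ _|j _]; last exact: (fP j).2.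
    by rewrite lee_fin share_ge0.
  apply: le_lt_trans (epsilon_trick _ _ _) _ => [j|//|].
    by rewrite mule_ge0 ?diam_pow_ge0 // lee_fin; lra.
  rewrite nneseriesZl; last by move=> j _; exact: diam_pow_ge0.
  apply: (@lt_le_trans _ _ (C'%:E * ((4 * C')^-1)%:E + (4^-1)%:E)%E).
    by rewrite lteD2rE // lte_pmul2l // lte_fin; lra.
  have c0 : C' != 0 by rewrite gt_eqF //; lra.
  have -> : (4 * C')^-1 = 4^-1 / C' by rewrite invfM.
  by rewrite -EFinM mulrC divfK // -EFinD lee_fin; lra.
have [x Xx xv] := branch_point vS vP.
have [j _ Ujx] := cov x Xx.
by have /negP[] := vB j; rewrite -xv; apply: (fP j).1.
Qed.
End limit.

(** * One stage of the construction *)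

(** One stage: the cells S of level j are replaced by the cells S' of level j',
through the intermediate level i.  The exponent b is the dimension that the
size of S' still guarantees at scale 2 ^ - j'. *)
Definition refinement (R : realType) (d n : nat) (K : set 'rV[R]_(n * d))
    (b : R) (j : nat) (S : seq (cell d)) (i j' : nat) (S' : seq (cell d)) :=
  [/\ (j < i <= j')%N, uniq S',
      {in S' &, injective (coarsen (j' - i))},
      (forall w, w \in S' -> coarsen (j' - j) w \in S /\
         forall a, (w a).+1 < (w a %/ 2 ^ (j' - j)).+1 * 2 ^ (j' - j))%N &
      [/\ forall u, u \in S ->
           (count (fun w => coarsen (j' - j) w == u) S'
             = 2 ^ (d * (i - j) - 1))%N,
         2 `^ (j'%:R * b) <= (size S')%:R
       & forall x : 'I_n -> 'rV[R]_d, (forall o, cell_of j' (x o) \in S') ->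
           injective (fun o => cell_of j' (x o)) -> ~ K (concat_point x)]].

(** The choice of the scales.  The intermediate level j + p is the integer part
of j' * (beta - e) / d for a small e.  With d * (j + p) about j' * (beta - e),
the right-hand side of the third conclusion is about
n * d * j' - (n - 1) * j' * (beta - e) = j' * (alpha + (n - 1) * e), up to an
error that does not depend on j'; as n - 1 >= 1, this exceeds
j' * (alpha + e / 2) for large j'.  The fourth follows likewise from e < eps.
That p is positive uses beta > 0, and that q is not negative uses beta <= d,
that is d <= alpha. *)
Lemma refinement_levels (R : realType) (d n : nat) (alpha eps : R) (j : nat) :
  (0 < d)%N -> (1 < n)%N -> d%:R <= alpha < (n * d)%:R -> 0 < eps ->
  exists (eps' : R) (J : nat), 0 < eps' /\ forall j', (J <= j')%N ->
    exists p q : nat, [/\ (0 < p)%N, j' = (j + (p + q.+1))%N,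
      j'%:R * (alpha + eps') <= (d * p - 1 + d * q * n)%:R
    & j'%:R * (((n * d)%:R - alpha) / (n%:R - 1) - eps) <= (d * p - 1)%:R].
Proof.
move=> d0 n1 /andP[dalpha alphand] eps0.
set beta := (_ / _).
have n1R : 0 < n%:R - 1 :> R by rewrite subr_gt0 ltr1n.
have d0R : 0 < d%:R :> R by rewrite ltr0n.
have betaE : (n%:R - 1) * beta = (n * d)%:R - alpha.
  by rewrite /beta mulrC divfK // gt_eqF.
have beta0 : 0 < beta by rewrite divr_gt0 // subr_gt0.
have betad : beta <= d%:R.
  by rewrite ler_pdivrMr // mulrBr mulr1 -natrM mulnC; lra.
pose e := Num.min eps beta / 2.
have e0 : 0 < e by rewrite divr_gt0 // lt_min eps0 beta0.
have eeps : e <= eps / 2 by rewrite ler_pM2r ?invr_gt0 // ge_min lexx.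
have ebeta : e <= beta / 2.
  by rewrite ler_pM2r ?invr_gt0 // ge_min lexx orbT.
have g0 : 0 < beta - e by lra.
pose c := (d * j + 1 + n * d)%N.
exists (e / 2), (maxn (Num.truncn (c%:R / (e / 2))).+1
  (Num.truncn ((d * j.+1)%:R / (beta - e))).+1).
split=> [|j']; first by lra.
rewrite geq_max => /andP[J1 J2].
have {J1} J1 : c%:R <= j'%:R * (e / 2).
  have e20 : 0 < e / 2 by lra.
  rewrite -(ler_pdivrMr _ _ e20); apply: ltW.
  by rewrite (lt_le_trans (truncnS_gt _)) // ler_nat.
have {J2} J2 : (d * j.+1)%:R <= j'%:R * (beta - e).
  rewrite -ler_pdivrMr //; apply: ltW.
  by rewrite (lt_le_trans (truncnS_gt _)) // ler_nat.
have j'0 : 0 <= j'%:R :> R by [].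
pose i := Num.truncn (j'%:R * (beta - e) / d%:R).
have ile : d%:R * i%:R <= j'%:R * (beta - e).
  by rewrite mulrC -ler_pdivlMr // truncn_le divr_ge0 // mulr_ge0 // ltW.
have igt : j'%:R * (beta - e) < d%:R * i%:R + d%:R.
  have := truncnS_gt (j'%:R * (beta - e) / d%:R).
  by rewrite -/i ltr_pdivrMr // -natr1; lra.
have ji : (j < i)%N.
  rewrite truncn_ge_nat; last by rewrite divr_ge0 // mulr_ge0 // ltW.
  by rewrite ler_pdivlMr // mulrC -natrM.
have ij' : (i < j')%N.
  rewrite -(ltr_nat R) -(ltr_pM2l d0R); apply: le_lt_trans ile _.
  rewrite mulrC ltr_pM2r; first by lra.
  rewrite ltr0n; apply: leq_ltn_trans (leq0n _) (_ : (0 < j')%N).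
  rewrite lt0n; apply: contraTneq J1 => ->.
  by rewrite mul0r -ltNge ltr0n /c addn1.
exists (i - j)%N, (j' - i).-1; split; first by rewrite subn_gt0.
- by rewrite prednK ?subn_gt0 // addnA subnKC ?(ltnW ji) // subnKC ?(ltnW ij').
- have -> : (d * (i - j) - 1 + d * (j' - i).-1 * n)%:R
    = d%:R * i%:R - d%:R * j%:R - 1 + d%:R * n%:R * (j'%:R - i%:R - 1) :> R.
    rewrite natrD natrB ?muln_gt0 ?d0 ?subn_gt0 //.
    rewrite !natrM natrB ?(ltnW ji) // -subn1 natrB ?subn_gt0 //.
    by rewrite natrB ?(ltnW ij') //; ring.
  move: J1 betaE; rewrite /c !natrD !natrM => J1 betaE.
  have h : (n%:R - 1) * (d%:R * i%:R) <= (n%:R - 1) * (j'%:R * (beta - e)).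
    by rewrite ler_pM2l.
  have h2 : 0 <= (n%:R - 2) * (j'%:R * e).
    have n2 : 2 <= n%:R :> R by rewrite ler_nat.
    by apply: mulr_ge0; [lra | apply: mulr_ge0 => //; exact: ltW].
  have h3 : j'%:R * ((n%:R - 1) * beta) = j'%:R * (n%:R * d%:R - alpha).
    by rewrite betaE.
  lra.
have -> : (d * (i - j) - 1)%:R = d%:R * i%:R - d%:R * j%:R - 1 :> R.
  rewrite natrB ?muln_gt0 ?d0 ?subn_gt0 // natrM natrB ?(ltnW ji) //.
  by rewrite mulrBr.
have h1 : j'%:R * (beta - eps) <= j'%:R * (beta - 2 * e).
  by rewrite ler_wpM2l //; lra.
have h2 : d%:R <= (n * d)%:R :> R by rewrite ler_nat leq_pmull // ltnW.
have h3 : 0 <= d%:R * j%:R :> R by rewrite mulr_ge0.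
by move: J1; rewrite /c !natrD (natrM _ d j); lra.
Qed.

Lemma exists_refinement (R : realType) (d n : nat) (alpha eps : R)
    (K : set 'rV[R]_(n * d)) (j : nat) (S : seq (cell d)) :
  (0 < d)%N -> (1 < n)%N -> d%:R <= alpha < (n * d)%:R -> 0 < eps ->
  dyadically_thin alpha K -> uniq S -> (0 < size S)%N ->
  exists (i j' : nat) (S' : seq (cell d)),
    refinement K (((n * d)%:R - alpha) / (n%:R - 1) - eps) j S i j' S'.
Proof.
move=> d0 n1 halpha eps0 thinK uniqS; case: S uniqS => // u0 S0.
set S := u0 :: S0 => uniqS _.
have [e [J [e0 JP]]] := refinement_levels j d0 n1 halpha eps0.
have [j' [B [Jj' leB BK]]] := thinK e J e0.
have [p [q [p0 j'E le1 le2]]] := JP j' Jj'.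
pose split (w : cell (n * d)) : {ffun 'I_n -> cell d} :=
  [ffun o => [ffun a => w (mxvec_index o a)]].
have [|||||S' [uS' inner injS' [parS' cntS'] avoid]] :=
  @refine_avoiding d n p q S (map split B) => //.
- exact: ltnW.
- rewrite size_map -expnD -(ler_nat R); apply: le_trans leB _.
  by rewrite natrX -powR_mulrn // ler_powR // ler1n.
have ej : (j' - j = p + q.+1)%N by lia.
have ei : (j' - (j + p) = q.+1)%N by lia.
have ep : (j + p - j = p)%N by lia.
exists (j + p)%N, j', S'; split; rewrite ?ej ?ei ?ep //; first by lia.
  by move=> w wS'; split; [exact: parS' | exact: inner].
split => // [|x xS' xinj Kx].
  apply: (@le_trans _ _ (2 ^ (d * p - 1))%:R).
    by rewrite natrX -powR_mulrn // ler_powR // ler1n.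
  by rewrite ler_nat -(cntS' u0 (mem_head _ _)) count_size.
have /negP : [ffun o => cell_of j' (x o)] \notin map split B.
  by apply: avoid => [u|u u']; rewrite !ffunE; [exact: xS' | exact: xinj].
apply; apply/mapP; exists (cell_of j' (concat_point x)); first exact: BK.
by apply/ffunP => o; apply/ffunP => a; rewrite !ffunE concat_pointE.
Qed.

(** * The avoiding set *)

Lemma cells_separate (R : realType) (d : nat) (x y : 'rV[R]_d) :
  (forall a, 0 <= x 0 a) -> (forall a, 0 <= y 0 a) -> x <> y ->
  exists J, forall j, (J <= j)%N -> cell_of j x <> cell_of j y.
Proof.
move=> x0 y0 xy.
have [a xya] : exists a, x 0 a != y 0 a.
  apply: contrapT => same; apply: xy; apply/rowP => a.
  apply/eqP/negPn/negP => h; by apply: same; exists a.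
have [J JP] := pow2_eventually_ge `|x 0 a - y 0 a|^-1 (@ltr01 R).
exists J => j /JP; rewrite mulr1 powR_mulrn // => le /ffunP/(_ a).
rewrite !ffunE => e.
have j0 : 0 < 2 ^+ j :> R by rewrite exprn_gt0.
have /andP[h1 h2] := truncn_itv (mulr_ge0 (ltW j0) (x0 a)).
have /andP[h3 h4] := truncn_itv (mulr_ge0 (ltW j0) (y0 a)).
move: h1 h2; rewrite e => h1 h2.
have : `|2 ^+ j * x 0 a - 2 ^+ j * y 0 a| < 1.
  by move: h2 h4; rewrite -natr1 ltr_norml => h2 h4; apply/andP; split; lra.
rewrite -mulrBr normrM gtr0_norm // ltNge => /negP; apply.
by rewrite mulrC -ler_pdivrMl ?mulr1 // normr_gt0 subr_eq0.
Qed.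

Lemma cells_separate_tuple (R : realType) (d n : nat) (x : 'I_n -> 'rV[R]_d) :
  (forall u a, 0 <= x u 0 a) -> injective x ->
  exists J, forall j, (J <= j)%N -> injective (fun u => cell_of j (x u)).
Proof.
move=> x0 xinj.
have /choice[J JP] : forall uv : 'I_n * 'I_n, exists J, uv.1 != uv.2 ->
    forall j, (J <= j)%N -> cell_of j (x uv.1) <> cell_of j (x uv.2).
  move=> [u u'] /=; have [->|uv'] := eqVneq u u'; first by exists 0%N.
  have [J JP] : exists J, forall j, (J <= j)%N ->
      cell_of j (x u) <> cell_of j (x u').
    by apply: cells_separate => // /xinj/eqP; apply/negP.
  by exists J.
exists (\max_uv J uv)%N => j /bigmax_leqP Jj u u' e.
by apply/eqP/negPn/negP => /(JP (u, u'))/(_ j (Jj _ isT)).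
Qed.

Theorem theorem1 (R : realType) (d n : nat) (hd : (1 <= d)%N) (hn : (2 <= n)%N)
    (alpha : R) (halpha : d%:R <= alpha < (n * d)%:R)
    (F : set (set 'rV[R]_(n * d))) (Fcountable : countable F)
    (Fcompact : forall K, F K -> compact K)
    (Fdim : forall K, F K -> (lower_minkowski_dim K <= alpha%:E)%E)
    (Z : set 'rV[R]_(n * d)) (hZ : Z = \bigcup_(K in F) K) :
  exists X : set 'rV[R]_d,
    [/\ forall x, X x -> forall j, 0 <= x 0 j < 1,
        ((((n * d)%:R - alpha) / (n%:R - 1))%:E <= hausdorff_dim X)%E
      & forall x : 'I_n -> 'rV[R]_d,
          (forall i, X (x i)) -> injective x -> ~ Z (concat_point x)].
Proof.
set beta := (_ / _).
have Fthin K : F K -> dyadically_thin alpha K.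
  move=> FK; have /andP[dalpha _] := halpha.
  apply: compact_dyadically_thin (Fcompact _ FK) (Fdim _ FK).
  by rewrite (le_trans _ dalpha).
have /countable_injP[h hinj] := Fcountable.
have /choice[g gP] : forall i : nat, exists K, dyadically_thin alpha K /\
    forall K', F K' -> h K' = i -> K' = K.
  move=> i; have [[K [FK hK]]|none] := pselect (exists K, F K /\ h K = i).
    exists K; split; first exact: Fthin.
    by move=> K' FK' hK'; apply: hinj; rewrite ?inE // hK hK'.
  exists set0; split; last by move=> K' FK' hK'; case: none; exists K'.
  by move=> eps J _; exists J, [::]; split => //; rewrite powR_ge0.
(* logn 2 takes every value infinitely often, so each K is treated again at
   stages where given distinct points are already in distinct cells *)
pose target k := g (logn 2 k).
pose state : Type := (nat * seq (cell d))%type.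
have [f fP] : {f : nat * state -> nat * state & forall ks : nat * state,
    uniq ks.2.2 -> (0 < size ks.2.2)%N ->
    refinement (target ks.1) (beta - ks.1.+1%:R^-1) ks.2.1 ks.2.2
      (f ks).1 (f ks).2.1 (f ks).2.2}.
  apply: (@choice _ _ (fun (ks : nat * state) (js : nat * state) =>
    uniq ks.2.2 -> (0 < size ks.2.2)%N ->
    refinement (target ks.1) (beta - ks.1.+1%:R^-1) ks.2.1 ks.2.2
      js.1 js.2.1 js.2.2)) => -[k [j S]] /=.
  have [[uS S0]|nS] := pselect (uniq S /\ (0 < size S)%N); last first.
    by exists (0%N, (0%N, [::])) => ? ?; case: nS.
  have k0 : 0 < k.+1%:R^-1 :> R by rewrite invr_gt0.
  have [i [j' [S' S'P]]] := exists_refinement j hd hn halpha k0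
    (gP (logn 2 k)).1 uS S0.
  by exists (i, (j', S')).
pose st := fix st k : state :=
  if k is k'.+1 then (f (k', st k')).2 else (0%N, [:: [ffun=> 0%N]]).
pose lev k := (st k).1; pose S k := (st k).2; pose mid k := (f (k, st k)).1.
have ok k : uniq (S k) /\ (0 < size (S k))%N.
  elim: k => // k [uS S0].
  have [ji uS' _ _ [_ sz _]] := fP (k, st k) uS S0; split => //.
  by rewrite -(ltr_nat R); apply: lt_le_trans sz; rewrite powR_gt0.
have step k : refinement (target k) (beta - k.+1%:R^-1) (lev k) (S k)
    (mid k) (lev k.+1) (S k.+1).
  by have [uS S0] := ok k; exact: (fP (k, st k) uS S0).
pose m k := (2 ^ (d * (mid k - lev k) - 1))%N.
have mid_lev k : (lev k < mid k <= lev k.+1)%N by have [] := step k.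
have tree : cell_tree lev S m.
  split => // k.
  - by have /andP[/leq_trans] := mid_lev k; apply.
  - by have [] := ok k.
  - by rewrite expn_gt0.
  - by move=> w; have [_ _ _ par _] := step k; move/par => [].
  - by have [_ _ _ _ []] := step k.
have mid_inj k : {in S k.+1 &, injective (coarsen (lev k.+1 - mid k))}.
  by have [] := step k.
have inner k w : w \in S k.+1 -> forall a, ((w a).+1 <
    (w a %/ 2 ^ (lev k.+1 - lev k)).+1 * 2 ^ (lev k.+1 - lev k))%N.
  by have [_ _ _ h5 _] := step k; move/h5 => [].
have betad : beta <= d%:R.
  rewrite ler_pdivrMr ?subr_gt0 ?ltr1n // mulrBr mulr1 -natrM mulnC.
  by have /andP[] := halpha; lra.
exists (@limit_set R d lev S); split.
- by move=> x [].
- apply: le_ereal_inf_tmp => _ [s [s0 Hs] <-]; rewrite lee_fin leNgt.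
  apply/negP => sbeta; move: Hs.
  have [C sizeS] : exists C : R, forall k,
      2 `^ ((lev k)%:R * s) <= C * (size (S k))%:R.
    have sz1 k : 1 <= (size (S k))%:R :> R by rewrite ler1n; have [] := ok k.
    (* C absorbs the first stages, at which the loss of dimension k.+1%:R^-1 may
       still exceed beta - s *)
    pose k0 := (Num.truncn (beta - s)^-1).+1.
    pose C : R := 1 + \sum_(k < k0.+1) 2 `^ ((lev k)%:R * s).
    have sum0 (P : pred 'I_k0.+1) :
        0 <= \sum_(k < k0.+1 | P k) 2 `^ ((lev k)%:R * s) :> R.
      by apply: sumr_ge0 => k _; rewrite powR_ge0.
    have C1 : 1 <= C by rewrite lerDl sum0.
    exists C => k; have [kk0|] := ltnP k k0.+1.
      apply: (@le_trans _ _ C); last by rewrite ler_peMr // (le_trans ler01).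
      rewrite /C (bigD1 (Ordinal kk0)) //= addrCA lerDl addr_ge0 //.
    case: k => // k; rewrite ltnS => k0k.
    apply: (@le_trans _ _ (size (S k.+1))%:R); last by rewrite ler_peMl.
    have [_ _ _ _ [_ sz _]] := step k; apply: le_trans sz.
    apply: ler_powR; first by rewrite ler1n.
    rewrite ler_wpM2l // lerBrDr -lerBrDl.
    rewrite -[leRHS]invrK lef_pV2 ?posrE ?invr_gt0 ?subr_gt0 //.
    apply/ltW/(lt_le_trans (truncnS_gt _)); rewrite ler_nat.
    exact: leq_trans k0k (leqnSn k).
  apply: (hausdorff_measure_limit_neq0 tree mid_lev _ mid_inj inner
    hd _ sizeS) => //.
  by rewrite s0 (le_trans (ltW sbeta)).
- move=> x xX xinj; rewrite hZ => -[K FK Kx].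
  have [J JP] := cells_separate_tuple
    (fun u a => (andP ((xX u).1 a)).1) xinj.
  pose k := (2 ^ h K * J.*2.+1)%N.
  have kK : target k = K.
    rewrite /target /k lognM ?expn_gt0 // pfactorK //.
    rewrite [logn 2 J.*2.+1]lognE /= dvdn2 /= odd_double /= addn0.
    by apply/esym/(gP _).2.
  have [_ _ _ _ [_ _ avoid]] := step k.
  apply: (avoid x) => [u| |]; last by rewrite kK.
    exact: (xX u).2.
  apply: JP; apply: leq_trans (tree_lev_ge tree k.+1).
  rewrite /k; apply: leq_trans (leqnSn _).
  apply: leq_trans (leq_pmull _ _); last by rewrite expn_gt0.
  by rewrite -addnn; lia.
Qed.
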